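(* Let $Z\in\mathbb{R}^{p_1\times p_2}$ have independent mean-zero entries, and suppose there are $\sigma_1,\ldots,\sigma_{p_2}\ge 0$ and a constant $C_K>0$ such that $\|Z_{ij}/\sigma_j\|_{\psi_2}\le C_K$ for all $i,j$. Then there is a constant $C>0$ depending only on $C_K$ such that \[ \mathbb{E}\|ZZ^\top-\mathbb{E}ZZ^\top\|\le C\left(\sqrt{p_1\sum_{j=1}^{p_2}\sigma_j^4}+p_1\max_j\sigma_j^2\right). \]
   Context: $\|\cdot\|$ is the spectral norm. $\|X\|_{\psi_2}=\inf\{x>0:\mathbb{E}\exp((|X|/x)^2)\le 2\}$. *)

(* Defs.v *)
From HB Require Import structures.
From mathcomp Require Import all_boot all_order all_algebra.
From mathcomp Require Import all_classical all_reals all_analysis probability.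
Set Implicit Arguments. Unset Strict Implicit. Unset Printing Implicit Defensive.
Import Order.TTheory GRing.Theory Num.Theory.
Local Open Scope classical_set_scope.
Local Open Scope ring_scope.

Definition vnorm2 {R : realType} {n : nat} (v : 'cV[R]_n) : R :=
  Num.sqrt (\sum_(i < n) (v i ord0) ^+ 2).

Definition specnorm {R : realType} {m n : nat} (A : 'M[R]_(m, n)) : R :=
  sup [set vnorm2 (A *m v) | v in [set v : 'cV[R]_n | vnorm2 v <= 1]].

Definition psi2norm {d} {T : measurableType d} {R : realType}
  (P : probability T R) (X : T -> R) : \bar R :=
  ereal_inf [set x%:E | x in
    [set x : R | 0 < x /\ ('E_P[fun w => expR ((`|X w| / x) ^+ 2)] <= 2%:E)%E]].

(* Mutual independence of a finite family of real random variables: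
   the joint law of (X i)_i factorises on measurable rectangles.  (Taking
   B i = setT for unused indices gives the condition for every subfamily.) *)
Definition mutually_independent {d} {T : measurableType d} {R : realType}
  (P : probability T R) {I : finType} (X : I -> T -> R) : Prop :=
  forall B : I -> set R, (forall i, measurable (B i)) ->
    P [set w | forall i, B i (X i w)] = (\prod_(i : I) P [set w | B i (X i w)])%E.

Definition rmat {T : Type} {R : realType} {p1 p2 : nat}
  (Z : 'I_p1 -> 'I_p2 -> T -> R) (w : T) : 'M[R]_(p1, p2) :=
  \matrix_(i, j) Z i j w.

(* Main.v *)
Require Import Defs.
From HB Require Import structures.
From mathcomp Require Import all_boot all_order all_algebra.
From mathcomp Require Import all_classical all_reals all_analysis probability.
From mathcomp Require Import measurable_realfun ring lra.
Set Implicit Arguments. Unset Strict Implicit. Unset Printing Implicit Defensive.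
Import Order.TTheory GRing.Theory Num.Theory.
Local Open Scope classical_set_scope.
Local Open Scope ring_scope.

(* The spectral norm of a p x p matrix A is at most twice the maximum of x^T A y
   over a net of exp(O(p)) lattice vectors x, y of the unit ball, and for
   A = ZZ^T - E ZZ^T polarisation turns x^T A y into quadratic forms
   z^T A z = sum_j (Y_j^2 - E Y_j^2), where Y_j = sum_i z_i Z_ij with |z| <= 2.  The
   Y_j are independent and sub-Gaussian with variance proxy O(sigma_j^2), so each
   summand satisfies the Bernstein bound
   E exp(l (Y_j^2 - E Y_j^2)) <= exp(O(l^2 sigma_j^4)) for |l| <= c / sigma_j^2.
   Summing the exponential moments over the net and using
   u <= s + exp(u - s) with s = O(p) gives E |A| <= O(p / l), and the choice
   l ~ p / (sqrt (p sum_j sigma_j^4) + p max_j sigma_j^2) yields the claim.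

   The degenerate columns sigma_j = 0 are covered by running the argument with
   sigma_j^2 + e in place of sigma_j^2 and letting e tend to 0. *)

(** * Independence of generated sigma-algebras *)

(** Both [A -> P (A & E)] and [A -> P E * P A] are finite measures. They agree on a pi-system
    containing the whole space, hence on the sigma-algebra that it generates. *)
Lemma pi_system_indep d (T : measurableType d) (R : realType)
    (P : probability T R) (G : set (set T)) (E : set T) :
  G `<=` measurable -> setI_closed G -> G setT -> measurable E ->
  (forall A, G A -> P (A `&` E) = (P A * P E)%E) ->
  forall A, <<s G >> A -> P (A `&` E) = (P A * P E)%E.
Proof.
move=> GM GI GT mE GE A sA.
have PE : (0 <= fine (P E))%R by rewrite fine_ge0.
have PEE : ((NngNum PE)%:num%:E = P E)%E by rewrite /= fineK// fin_num_measure.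
suff: mrestr P mE A = mscale (NngNum PE) P A.
  by rewrite /mrestr /mscale PEE muleC.
apply: (@g_sigma_algebra_measure_unique _ _ _ G GM (fun=> setT)) => //.
- by rewrite bigcup_const.
- by move=> B GB; rewrite /= /mrestr /mscale PEE muleC; exact: GE.
- by move=> _; rewrite /= /mrestr setTI (le_lt_trans (probability_le1 P mE))// ltry.
Qed.

(** The one-sided extension is applied twice: first to replace [G] by [<<s G>>] with the other event
    fixed, then in the same way for [H]. *)
Lemma sigma_indep d (T : measurableType d) (R : realType)
    (P : probability T R) (G H : set (set T)) :
  G `<=` measurable -> setI_closed G -> G setT ->
  H `<=` measurable -> setI_closed H -> H setT ->
  (forall A B, G A -> H B -> P (A `&` B) = (P A * P B)%E) ->
  forall A B, <<s G >> A -> <<s H >> B -> P (A `&` B) = (P A * P B)%E.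
Proof.
move=> GM GI GT HM HI HT GH A B sA sB.
have mB : measurable B.
  by move: sB; apply: smallest_sub => //; exact: sigma_algebra_measurable.
apply: (@pi_system_indep d T R P G) => // C GC.
rewrite setIC muleC; apply: (@pi_system_indep d T R P H) => //.
- exact: GM.
- by move=> D HD; rewrite setIC muleC GH.
Qed.

(** Independence says that the diagonal map [x -> (x, x)], into two copies of [T] carrying [<<s G>>]
    and [<<s H>>], pushes [P] forward to the product of its restrictions. Tonelli's theorem then
    splits the integral. *)
Lemma integral_indepM d (T : measurableType d) (R : realType)
    (P : probability T R) (G H : set (set T)) (f : g_sigma_algebraType G -> \bar R)
    (g : g_sigma_algebraType H -> \bar R) :
  G `<=` measurable -> H `<=` measurable ->
  (forall A B, <<s G >> A -> <<s H >> B -> P (A `&` B) = (P A * P B)%E) ->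
  measurable_fun setT f ->
  measurable_fun setT g ->
  (forall x, 0 <= f x)%E -> (forall x, 0 <= g x)%E ->
  (\int[P]_x (f x * g x) = (\int[P]_x f x) * (\int[P]_x g x))%E.
Proof.
move=> GM HM GH mf mg f0 g0.
have sub (K : set (set T)) : K `<=` measurable -> <<s K >> `<=` measurable.
  by move=> KM; apply: smallest_sub => //; exact: (@sigma_algebra_measurable d T).
have mid (K : set (set T)) : K `<=` measurable ->
    measurable_fun setT (id : T -> g_sigma_algebraType K).
  by move=> /sub KM _ B mB; rewrite setTI; exact: KM.
pose TG := g_sigma_algebraType G; pose TH := g_sigma_algebraType H.
pose iG : {mfun T >-> TG} := mfun_Sub (mem_set (mid G GM)).
pose iH : {mfun T >-> TH} := mfun_Sub (mem_set (mid H HM)).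
pose PG : probability TG R := distribution P iG.
pose PH : probability TH R := distribution P iH.
pose phi (x : T) : TG * TH := (x, x).
have mphi : measurable_fun setT phi.
  by apply/measurable_fun_pairP; split; exact: (mid _).
pose iP : {mfun T >-> (TG * TH)%type} := mfun_Sub (mem_set mphi).
have PGH := @product_measure_unique _ _ TG TH R PG PH (distribution P iP).
have mFG : measurable_fun setT (fun z : TG * TH => (f z.1 * g z.2)%E).
  apply: emeasurable_funM; apply: measurableT_comp => //.
have -> : (\int[P]_x (f x * g x) = \int[pushforward P phi]_z (f z.1 * g z.2))%E.
  rewrite ge0_integral_pushforward//.
  by move=> z _; rewrite mule_ge0.
transitivity (\int[(PG \x PH)%E]_z (f z.1 * g z.2))%E.
  by apply: eq_measure_integral => A mA _; apply/esym/PGH => // B C; exact: GH.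
rewrite (fubini_tonelli1 (fun z : TG * TH => (f z.1 * g z.2)%E))//; last first.
  by move=> z; rewrite mule_ge0.
rewrite /fubini_F/=.
under eq_integral do rewrite ge0_integralZl//.
rewrite ge0_integralZr//; last exact: integral_ge0.
rewrite /PG /PH /distribution !ge0_integral_pushforward//; exact: (mid _).
Qed.

(** * Cylinder events: pi-systems generating the sigma-algebras of subfamilies *)

Definition cylinders {T : Type} {R : realType} {I : finType}
    (X : I -> T -> R) (A : {pred I}) : set (set T) :=
  [set S | exists2 B : I -> set R, (forall i, measurable (B i)) &
    S = [set w | forall i, i \in A -> B i (X i w)]].

Section cylinders.
Context d (T : measurableType d) (R : realType) (I : finType).
Variables (X : I -> T -> R).
Implicit Types A : {pred I}.

Lemma cylinders_setT A : cylinders X A setT.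
Proof. by exists (fun=> setT) => //; apply/seteqP; split. Qed.

Lemma cylinders_setI A : setI_closed (cylinders X A).
Proof.
move=> _ _ [B mB ->] [C mC ->]; exists (fun i => B i `&` C i).
  by move=> i; exact: measurableI.
apply/seteqP; split=> w /=; first by move=> [HB HC] i iA; split; [exact: HB|exact: HC].
by move=> H; split=> i /H[].
Qed.

Lemma cylinders_measurable A : (forall i, measurable_fun setT (X i)) ->
  cylinders X A `<=` measurable.
Proof.
move=> mX _ [B mB ->].
rewrite (_ : [set w | _] = \bigcap_(i in [set i | i \in A]) (X i @^-1` B i))//.
apply: fin_bigcap_measurable => // i _.
by rewrite -[X in measurable X]setTI; exact: mX.
Qed.

Lemma cylinders_sub A A' : {subset A <= A'} -> cylinders X A `<=` cylinders X A'.
Proof.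
move=> AA' _ [B mB ->]; exists (fun i => if i \in A then B i else setT).
  by move=> i; case: ifP.
apply/seteqP; split=> w /= H i.
  by move=> _; case: ifPn => // iA; exact: H.
by move=> iA; have := H i (AA' _ iA); rewrite iA.
Qed.

Lemma measurable_fun_cylinders_sub A A' d' (U : measurableType d') (f : T -> U) :
  {subset A <= A'} ->
  measurable_fun (T := g_sigma_algebraType (cylinders X A)) setT f ->
  measurable_fun (T := g_sigma_algebraType (cylinders X A')) setT f.
Proof.
move=> AA' mf mT B mB; have := mf measurableT B mB.
by apply: sub_smallest2r; [exact: smallest_sigma_algebra|exact: cylinders_sub].
Qed.

Lemma measurable_fun_cylinders A i : i \in A ->
  measurable_fun (T := g_sigma_algebraType (cylinders X A)) setT (X i).
Proof.
move=> iA _ B mB; rewrite setTI; apply: sub_sigma_algebra.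
exists (fun k => if k == i then B else setT) => [k|]; first by case: ifP.
apply/seteqP; split=> w /= H; first by move=> k _; case: eqP => // ->.
by have := H _ iA; rewrite eqxx.
Qed.

Variable P : probability T R.
Hypothesis mX : forall i, measurable_fun setT (X i).
Hypothesis indX : mutually_independent P X.

(** An intersection of cylinders over disjoint index sets is again a rectangle. Filling the
    unconstrained coordinates with [setT] makes the factorisation of the full joint law apply to it,
    and each filler contributes a factor 1. *)
Lemma cylinders_indep A A' : [predI A & A'] =i pred0 ->
  forall S S', cylinders X A S -> cylinders X A' S' ->
  P (S `&` S') = (P S * P S')%E.
Proof.
move=> dAA' _ _ [B mB ->] [C mC ->].
have PT i : P [set w | setT (X i w)] = 1%E.
  by rewrite -(probability_setT P); congr (P _); apply/seteqP.
have PA (D : {pred I}) (E : I -> set R) : (forall i, measurable (E i)) ->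
    P [set w | forall i, i \in D -> E i (X i w)] =
    (\prod_(i in D) P [set w | E i (X i w)])%E.
  move=> mE; rewrite big_mkcond/=.
  transitivity (P [set w | forall i, (if i \in D then E i else setT) (X i w)]).
    congr (P _); apply/seteqP; split=> w /= H i; first by case: ifPn => // /H.
    by move=> iD; have := H i; rewrite iD.
  rewrite (@indX (fun i => if i \in D then E i else setT)); last first.
    by move=> i; case: ifP.
  by apply: eq_bigr => i _; case: ifP.
rewrite !PA// [X in (X * _)%E]big_mkcond [X in (_ * X)%E]big_mkcond/= -big_split/=.
transitivity (P [set w | forall i, (if i \in A then B i else if i \in A' then C i else setT) (X i w)]).
  congr (P _); apply/seteqP; split=> w /=.
    by move=> [HB HC] i; case: ifPn => [/HB//|_]; case: ifPn => // /HC.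
  move=> H; split=> i iA; have := H i; rewrite iA//.
  by have := dAA' i; rewrite !inE iA andbT => ->.
rewrite (@indX (fun i => if i \in A then B i else if i \in A' then C i else setT)).
  apply: eq_bigr => i _; have := dAA' i; rewrite !inE.
  by case: (i \in A) => [/= ->|_]; rewrite ?mule1// mul1e; case: (i \in A').
by move=> i; case: ifP => // _; case: ifP.
Qed.

(** The fibres of [pr] cut the family into disjoint blocks, and [g j] depends on block [j] only. The
    factors are split off one block at a time, the head being independent of the product over the
    remaining blocks. Below, [pr] is the identity for single entries and [snd] for columns. *)
Lemma expectation_prod_indep (J : finType) (pr : I -> J) (g : J -> T -> R) :
  (forall j, measurable_fun
    (T := g_sigma_algebraType (cylinders X [pred i | pr i == j])) setT (g j)) ->
  (forall j w, 0 <= g j w)%R ->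
  ('E_P[fun w => (\prod_j g j w)%R] = \prod_j 'E_P[g j])%E.
Proof.
move=> mg g0; rewrite unlock; elim: (index_enum J) (index_enum_uniq J) => [_|j s IH].
  rewrite big_nil; under eq_integral do rewrite big_nil.
  by rewrite integral_cst//= probability_setT mule1.
move=> /= /andP[js us]; rewrite big_cons -IH//.
under eq_integral do rewrite big_cons EFinM.
set G := cylinders X [pred i | pr i == j].
set H := cylinders X [pred i | pr i \in s].
have GM : G `<=` measurable by exact: cylinders_measurable.
have HM : H `<=` measurable by exact: cylinders_measurable.
apply: (@integral_indepM _ _ _ P G H (fun w => (g j w)%:E)
  (fun w => (\prod_(k <- s) g k w)%:E) GM HM).
- apply: sigma_indep => //; [exact: cylinders_setI|exact: cylinders_setT|
    exact: cylinders_setI|exact: cylinders_setT|].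
  apply: cylinders_indep => i; rewrite !inE; apply/negbTE/negP => /andP[/eqP ->].
  by move=> H'; rewrite H' in js.
- by apply/measurable_EFinP; exact: mg.
- apply/measurable_EFinP; elim: s {IH js us} @H HM => [|k s IH] H HM.
    by under eq_fun do rewrite big_nil; exact: measurable_cst.
  under eq_fun do rewrite big_cons; apply: measurable_funM.
    apply: measurable_fun_cylinders_sub (mg k) => i /=.
    by rewrite !inE => /eqP ->; rewrite eqxx.
  apply: measurable_fun_cylinders_sub (IH _) => [i/=|].
    by rewrite !inE => ->; rewrite orbT.
  exact: cylinders_measurable.
- by move=> w; rewrite lee_fin.
- by move=> w; rewrite lee_fin prodr_ge0.
Qed.

End cylinders.

(** * Sub-Gaussian variables and their squares *)

Section real_inequalities.
Context {R : realType}.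
Implicit Types t u x y : R.

Lemma le_expR x : x <= expR x.
Proof. by have := expR_ge1Dx x; lra. Qed.

(** Squaring [1 + t/2 <= expR (t/2)] for [t >= 0] gives the factor 4. *)
Lemma sqr_le_expR t : t ^+ 2 <= 4 * expR `|t|.
Proof.
rewrite -real_normK ?num_real//; move: `|t| (normr_ge0 t) => {}t t0.
have -> : expR t = expR (t / 2) ^+ 2 by rewrite -expRM_natl; congr expR; lra.
have := expR_ge1Dx (t / 2); nra.
Qed.

(** For [u >= 0], the inequality [expR u <= 1 + u * expR u] is inserted into itself. For [u < 0],
    multiplying [u <= expR u - 1] by [u] bounds [u * expR u] by [u + u^2]. *)
Lemma expR_le_quadratic u : expR u <= 1 + u + u ^+ 2 * expR `|u|.
Proof.
have h : expR u <= 1 + u * expR u.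
  have e0 := expR_gt0 u; have := expR_ge1Dx (- u); rewrite expRN => h.
  have : (1 - u) * expR u <= (expR u)^-1 * expR u by rewrite ler_pM2r//; lra.
  by rewrite mulVf ?gt_eqF//; lra.
have h1 := expR_ge1Dx u.
have [u0|u0] := leP 0 u; first by rewrite ger0_norm//; nra.
have : u ^+ 2 <= u ^+ 2 * expR `|u|.
  by rewrite ler_peMr ?sqr_ge0// -expR0 ler_expR.
nra.
Qed.

(* The discrete Gaussian sum: completing the square at [n = floor |y|] loses at
   most a factor [expR (1/2)], which replaces the Gaussian integral in the usual
   linearisation of [expR (y^2/2)]. *)
Lemma expR_sqr_le_nneseries y :
  ((expR (y ^+ 2 / 2))%:E <= \sum_(0 <= n <oo)
    (expR 2^-1 * (expR (n%:R * y) + expR (n%:R * - y)) * expR (- (n%:R ^+ 2 / 2)))%:E)%E.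
Proof.
pose f (n : nat) := (expR 2^-1 * (expR (n%:R * y) + expR (n%:R * - y)) *
  expR (- (n%:R ^+ 2 / 2)))%:E.
rewrite -/f.
pose n := Num.truncn `|y|.
have f0 k : (0 <= f k)%E.
  by rewrite /f lee_fin !mulr_ge0 ?expR_ge0// addr_ge0 ?expR_ge0.
apply: (@le_trans _ _ (f n)); last first.
  apply: le_trans (nneseries_lim_ge n.+1 _) => //.
  by rewrite big_nat_recr//= leeDr// sume_ge0.
rewrite /f lee_fin.
have yE : expR (n%:R * `|y|) <= expR (n%:R * y) + expR (n%:R * - y).
  by case: (ger0P y) => y0; rewrite ?lerDl ?lerDr expR_ge0.
apply: (@le_trans _ _ (expR 2^-1 * expR (n%:R * `|y|) * expR (- (n%:R ^+ 2 / 2)))).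
  rewrite -!expRD ler_expR -(real_normK (num_real y)).
  have /andP[] := truncn_itv (normr_ge0 y); rewrite -/n -natr1; nra.
by rewrite ler_pM2r ?expR_gt0// ler_pM2l ?expR_gt0.
Qed.

End real_inequalities.

Section expectation.
Context d (T : measurableType d) (R : realType) (P : probability T R).
Implicit Types f g h X : T -> R.

Lemma ge0_expectation_le f g : measurable_fun setT f -> measurable_fun setT g ->
  (forall w, 0 <= f w) -> (forall w, f w <= g w) -> ('E_P[f] <= 'E_P[g])%E.
Proof.
move=> mf mg f0 fg; rewrite unlock; apply: ge0_le_integral => //.
- by move=> w _; rewrite lee_fin.
- exact/measurable_EFinP.
- exact/measurable_EFinP.
- by move=> w _; rewrite lee_fin.
Qed.

Lemma ge0_expectationZl (k : R) f : measurable_fun setT f -> 0 <= k ->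
  (forall w, 0 <= f w) -> ('E_P[fun w => (k * f w)%R] = k%:E * 'E_P[f])%E.
Proof.
move=> mf k0 f0; rewrite unlock.
under eq_integral do rewrite EFinM.
rewrite ge0_integralZl//; first exact/measurable_EFinP.
by move=> w _; rewrite lee_fin.
Qed.

Lemma ge0_expectationD f g : measurable_fun setT f -> measurable_fun setT g ->
  (forall w, 0 <= f w) -> (forall w, 0 <= g w) ->
  ('E_P[fun w => (f w + g w)%R] = 'E_P[f] + 'E_P[g])%E.
Proof.
move=> mf mg f0 g0; rewrite unlock.
under eq_integral do rewrite EFinD.
rewrite ge0_integralD//; try exact/measurable_EFinP.
- by move=> w _; rewrite lee_fin.
- by move=> w _; rewrite lee_fin.
Qed.

Lemma ge0_integrable f (B : R) : measurable_fun setT f -> (forall w, 0 <= f w) ->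
  ('E_P[f] <= B%:E)%E -> P.-integrable setT (EFin \o f).
Proof.
move=> mf f0; rewrite unlock => fB; apply/integrableP; split.
  exact/measurable_EFinP.
apply: le_lt_trans (ltry B); apply: le_trans fB.
by under eq_integral do rewrite /= ger0_norm//.
Qed.

(** This serves to expand an exponential to second order: the centred linear term [X] drops out in
    expectation, and only the remainder [h] is left to be bounded. *)
Lemma expectation_le_centered f X h (B : R) :
  measurable_fun setT f -> (forall w, 0 <= f w) ->
  P.-integrable setT (EFin \o X) -> 'E_P[X]%E = 0%E ->
  measurable_fun setT h -> (forall w, 0 <= h w) -> ('E_P[h] <= B%:E)%E ->
  (forall w, f w <= 1 + X w + h w) ->
  ('E_P[f] <= (1 + B)%:E)%E.
Proof.
move=> mf f0 iX EX mh h0 hB fX.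
have ih := ge0_integrable mh h0 hB.
have mX : measurable_fun setT X by apply/measurable_EFinP; exact: measurable_int iX.
have i1 : P.-integrable setT (EFin \o cst 1) by exact: finite_measure_integrable_cst.
apply: (@le_trans _ _ 'E_P[fun w => (1 + X w + h w)%R])%E.
  apply: ge0_expectation_le => //.
  by apply: measurable_funD => //; exact: measurable_funD.
move: EX hB; rewrite unlock => EX hB.
under eq_integral do rewrite 2!EFinD.
rewrite integralD//; last exact: integrableD.
rewrite integralD// EX adde0 integral_cst//= probability_setT mul1e EFinD.
exact: leeD.
Qed.

(** In the second-order expansion of [expR (t X)] the linear term has mean zero, and the remainder
    is absorbed by [expR (X^2 / b)], whose mean is at most 2. *)
Lemma expectation_expR_subgaussian X (b : R) : 0 < b ->
  measurable_fun setT X -> P.-integrable setT (EFin \o X) -> 'E_P[X]%E = 0%E ->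
  ('E_P[fun w => expR (X w ^+ 2 / b)] <= 2%:E)%E ->
  forall t, ('E_P[fun w => expR (t * X w)] <= (expR (5 * b * t ^+ 2))%:E)%E.
Proof.
move=> b0 mX iX EX EX2 t.
pose c := b * t ^+ 2.
have c0 : 0 <= c by rewrite mulr_ge0 ?sqr_ge0// ltW.
have mX2 : measurable_fun setT (fun w => expR (X w ^+ 2 / b)).
  by apply: measurableT_comp => //; apply: measurable_funM => //; exact: measurable_funX.
apply: (@le_trans _ _ (1 + 4 * c * expR (c / 2))%:E).
  apply: (@expectation_le_centered _ (fun w => t * X w)
      (fun w => 2 * c * expR (c / 2) * expR (X w ^+ 2 / b))) => //.
  - by apply: measurableT_comp => //; exact: measurable_funM.
  - exact: (integrableZl measurableT t iX).
  - rewrite unlock; under eq_integral do rewrite EFinM.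
    by rewrite integralZl//; move: EX; rewrite unlock => ->; rewrite mule0.
  - exact: measurable_funM.
  - by move=> w /=; rewrite mulr_ge0 ?expR_ge0// mulr_ge0 ?expR_ge0// mulr_ge0.
  - rewrite ge0_expectationZl//; last first.
      by rewrite mulr_ge0 ?expR_ge0// mulr_ge0.
    rewrite (_ : 4 * c * expR (c / 2) = 2 * c * expR (c / 2) * 2); last by lra.
    rewrite [leRHS]EFinM; apply: lee_wpmul2l => //.
    by rewrite lee_fin mulr_ge0 ?expR_ge0// mulr_ge0.
  - move=> w; apply: le_trans (expR_le_quadratic _) _; rewrite lerD2l.
    (* The exponent [x^2 / b] is spent in two halves [u]: one dominates the factor
       [(t x)^2 = 2 c u], the other dominates [expR |t x|] through the AM-GM bound
       [|t x| <= c/2 + u]. *)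
    set x := X w; pose u := x ^+ 2 / (2 * b).
    have u0 : 0 <= u by rewrite divr_ge0 ?sqr_ge0// mulr_ge0// ltW.
    have -> : (t * x) ^+ 2 = 2 * c * u by rewrite /c /u; field; rewrite gt_eqF.
    have -> : x ^+ 2 / b = u + u by rewrite /u; field; rewrite gt_eqF.
    have tx : `|t * x| <= c / 2 + u.
      have sb : 0 < Num.sqrt b by rewrite sqrtr_gt0.
      have sb2 := sqr_sqrtr (ltW b0).
      have -> : c / 2 + u = ((Num.sqrt b * t) ^+ 2 + (x / Num.sqrt b) ^+ 2) / 2.
        by rewrite !exprMn exprVn sb2 /c /u; field; rewrite gt_eqF.
      have -> : t * x = (Num.sqrt b * t) * (x / Num.sqrt b).
        by field; rewrite gt_eqF.
      set p := _ * t; set q := _ / _; rewrite ler_norml; apply/andP; split.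
        by have := sqr_ge0 (p + q); nra.
      by have := sqr_ge0 (p - q); nra.
    apply: (@le_trans _ _ (2 * c * expR u * expR (c / 2 + u))).
      have c2 : 0 <= 2 * c by rewrite mulr_ge0.
      apply: ler_pM; [exact: mulr_ge0|exact: expR_ge0| |by rewrite ler_expR].
      by rewrite ler_wpM2l// le_expR.
    by rewrite !expRD; lra.
rewrite lee_fin -/c.
(* The chain is [1 + 4 c e^(c/2) <= e^(c/2) (1 + 4 c) <= e^(c/2) e^(4 c) <= e^(5 c)]. *)
have -> : 5 * b * t ^+ 2 = c / 2 + 4 * c + c / 2 by rewrite /c; lra.
have e1 : 1 <= expR (c / 2) by rewrite -expR0 ler_expR divr_ge0.
have e2 := expR_ge1Dx (4 * c).
rewrite -addrA [4 * c + _]addrC addrA !expRD.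
have : 1 * (1 + 4 * c) <= expR (c / 2) * expR (4 * c).
  by apply: ler_pM => //; lra.
nra.
Qed.

End expectation.

(** This is the sum of the geometric series [2 e^(1/2) q^n] with [q = e^(-1/4)], which will dominate
    the discrete Gaussian sum. *)
Definition chi_bound {R : realType} : R := 2 * expR 2^-1 / (1 - expR (- 4^-1)).

Lemma chi_bound_gt0 {R : realType} : 0 < chi_bound :> R.
Proof.
by rewrite divr_gt0 ?mulr_gt0 ?expR_gt0// subr_gt0 expR_lt1 oppr_lt0 invr_gt0.
Qed.

(** The factor is [1024 = 16 * 8^2]: 16 comes from bounding a square by an exponential, and 8 from
    the normalisation [Y^2 / (8 b)]. *)
Definition chernoff_const {R : realType} : R := 1024 * chi_bound * expR chi_bound.

Lemma chernoff_const_ge0 {R : realType} : 0 <= chernoff_const :> R.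
Proof.
apply: mulr_ge0; last exact: expR_ge0.
by apply: mulr_ge0; [exact: ler0n|exact: ltW chi_bound_gt0].
Qed.

Section subgaussian_square.
Context d (T : measurableType d) (R : realType) (P : probability T R).
Variables (Y : T -> R) (b : R).
Hypotheses (b0 : 0 < b) (mY : measurable_fun setT Y).
Hypothesis sgY :
  forall t, ('E_P[fun w => expR (t * Y w)] <= (expR (b * t ^+ 2))%:E)%E.

Lemma expectation_expR_sqr :
  ('E_P[fun w => expR (Y w ^+ 2 / (8 * b))] <= chi_bound%:E)%E.
Proof.
(* With this scale [(s Y)^2 / 2 = Y^2 / (8 b)]. The [n]-th term of the discrete Gaussian sum then
   has mean at most [2 e^(1/2) e^(n^2/4 - n^2/2)], and [n <= n^2] turns the decay into a geometric
   one. *)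
pose s := (2 * Num.sqrt b)^-1.
have sb : Num.sqrt b != 0 by rewrite gt_eqF// sqrtr_gt0.
have s2 : s ^+ 2 = (4 * b)^-1.
  by rewrite /s exprVn exprMn sqr_sqrtr 1?ltW// -natrX.
pose F (n : nat) w : R := expR 2^-1 *
  (expR (n%:R * (s * Y w)) + expR (n%:R * - (s * Y w))) * expR (- (n%:R ^+ 2 / 2)).
have mE (c : R) : measurable_fun setT (fun w => expR (c * Y w)).
  by apply: measurableT_comp => //; exact: measurable_funM.
have FE n : F n = fun w => expR 2^-1 * expR (- (n%:R ^+ 2 / 2)) *
    (expR (n%:R * s * Y w) + expR (- (n%:R * s) * Y w)).
  apply/funext => w; rewrite /F [RHS]mulrAC.
  by congr (_ * (expR _ + expR _) * _); ring.
have mF n : measurable_fun setT (F n).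
  by rewrite FE; apply: measurable_funM => //; exact: measurable_funD.
have F0 n w : 0 <= F n w by rewrite FE !mulr_ge0 ?addr_ge0 ?expR_ge0.
have EF n : ('E_P[F n] <= (2 * expR 2^-1 * expR (- 4^-1) ^+ n)%:E)%E.
  rewrite FE ge0_expectationZl//; last exact: measurable_funD.
  rewrite ge0_expectationD//; apply: (@le_trans _ _ ((expR 2^-1 * expR (- (n%:R ^+ 2 / 2)))%:E *
     (2 * expR (n%:R ^+ 2 / 4))%:E)%E).
    apply: lee_wpmul2l; first by rewrite lee_fin mulr_ge0 ?expR_ge0.
    have -> : 2 * expR (n%:R ^+ 2 / 4) = expR (n%:R ^+ 2 / 4) + expR (n%:R ^+ 2 / 4) :> R by ring.
    rewrite EFinD; apply: leeD; apply: (le_trans (sgY _)).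
      rewrite lee_fin ler_expR exprMn s2 le_eqVlt; apply/orP; left; apply/eqP.
      by field; rewrite gt_eqF.
    rewrite lee_fin ler_expR sqrrN exprMn s2 le_eqVlt; apply/orP; left; apply/eqP.
    by field; rewrite gt_eqF.
  rewrite -EFinM lee_fin -expRM_natl.
  have -> : expR 2^-1 * expR (- (n%:R ^+ 2 / 2)) * (2 * expR (n%:R ^+ 2 / 4)) =
    2 * expR 2^-1 * expR (- (n%:R ^+ 2 / 4)) :> R.
    rewrite (_ : - (n%:R ^+ 2 / 4) = - (n%:R ^+ 2 / 2) + n%:R ^+ 2 / 4); last by field.
    by rewrite expRD; ring.
  rewrite ler_pM2l ?mulr_gt0 ?expR_gt0// ler_expR.
  have : (n%:R <= n%:R ^+ 2 :> R) by rewrite -natrX ler_nat; case: n => // n; rewrite leq_pmulr.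
  lra.
apply: (@le_trans _ _ (\sum_(0 <= n <oo) 'E_P[F n])%E).
  rewrite unlock -integral_nneseries//; last 2 first.
  - by move=> n; exact/measurable_EFinP.
  - by move=> n w _; rewrite lee_fin.
  apply: ge0_le_integral => //.
  - apply/measurable_EFinP; apply: measurableT_comp => //.
    by apply: measurable_funM => //; exact: measurable_funX.
  - apply: ge0_emeasurable_sum => // n; first by move=> w _ _; rewrite lee_fin.
    by move=> _; exact/measurable_EFinP.
  move=> w _.
  have -> : Y w ^+ 2 / (8 * b) = (s * Y w) ^+ 2 / 2.
    by rewrite exprMn s2; field; rewrite gt_eqF.
  exact: expR_sqr_le_nneseries.
apply: lime_le; first by apply: is_cvg_nneseries => n _ _; exact: expectation_ge0.
apply: nearW => n; apply: (@le_trans _ _ (\sum_(0 <= k < n) (2 * expR 2^-1 * expR (- 4^-1) ^+ k)%:E)%E).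
  by apply: lee_sum => k _.
rewrite sumEFin lee_fin -mulr_sumr /chi_bound ler_pM2l ?mulr_gt0 ?expR_gt0//.
rewrite big_mkord; set q := expR _.
have q1 : q < 1 by rewrite expR_lt1 oppr_lt0 invr_gt0.
have q0 : 0 < q by exact: expR_gt0.
rewrite -[leRHS]mul1r ler_pdivlMr ?subr_gt0//.
have := subrX1 q n; have := exprn_ge0 n (ltW q0).
set S := \sum_(_ < _) _; lra.
Qed.

Lemma integrable_sqr_subgaussian :
  P.-integrable setT (EFin \o (fun w => Y w ^+ 2 / (8 * b))).
Proof.
apply: (@ge0_integrable _ _ _ _ _ chi_bound).
- by apply: measurable_funM => //; exact: measurable_funX.
- by move=> w; rewrite divr_ge0 ?sqr_ge0// mulr_ge0// ltW.
apply: le_trans expectation_expR_sqr; apply: ge0_expectation_le.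
- by apply: measurable_funM => //; exact: measurable_funX.
- apply: measurableT_comp => //.
  by apply: measurable_funM => //; exact: measurable_funX.
- by move=> w; rewrite divr_ge0 ?sqr_ge0// mulr_ge0// ltW.
- by move=> w; exact: le_expR.
Qed.

(** After rescaling to [W = Y^2 / (8 b)] the parameter becomes [s = 8 b l], and the hypothesis reads
    [|s| <= 1/2]. The deviation [D = W - mu] satisfies [|D| <= chi_bound + W]. In the second-order
    expansion one half of [|D|] in the exponent pays for [D^2] and the other half for
    [expR |s D|]. *)
Lemma expectation_expR_centered_sqr (l : R) : `|l| * b <= 16^-1 ->
  ('E_P[fun w => expR (l * (Y w ^+ 2 - fine 'E_P[fun w => (Y w ^+ 2)%R]%E))]
   <= (expR (chernoff_const * (l * b) ^+ 2))%:E)%E.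
Proof.
move=> lb.
pose W w := Y w ^+ 2 / (8 * b).
have W0 w : 0 <= W w by rewrite divr_ge0 ?sqr_ge0// mulr_ge0// ltW.
have mW : measurable_fun setT W by apply: measurable_funM => //; exact: measurable_funX.
have mEW : measurable_fun setT (fun w => expR (W w)) by exact: measurableT_comp.
have iW : P.-integrable setT (EFin \o W) := integrable_sqr_subgaussian.
have b8 : 8 * b != 0 by rewrite mulf_neq0// gt_eqF.
have EY : 'E_P[fun w => (Y w ^+ 2)%R]%E = ((8 * b)%:E * 'E_P[W])%E.
  rewrite -ge0_expectationZl//; last by rewrite mulr_ge0// ltW.
  by congr expectation; apply/funext => w; rewrite /W mulrC divfK.
have fW : 'E_P[W]%E \is a fin_num by rewrite unlock; exact: integrable_fin_num.
pose mu := fine 'E_P[W]%E.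
have muE : 'E_P[W]%E = mu%:E by rewrite fineK.
have EeW := expectation_expR_sqr; rewrite -/(W _) in EeW.
have mu0 : 0 <= mu by rewrite fine_ge0// expectation_ge0.
have muB : mu <= chi_bound.
  rewrite -lee_fin -muE; apply: le_trans EeW; apply: ge0_expectation_le => // w.
  exact: le_expR.
pose s := 8 * b * l; pose D w := W w - mu.
have sh : `|s| <= 2^-1.
  rewrite /s normrM ger0_norm; last by rewrite mulr_ge0// ltW.
  by have : 0 <= `|l| by []; nra.
rewrite EY muE -EFinM /=.
have -> : (fun w => expR (l * (Y w ^+ 2 - 8 * b * mu))) = (fun w => expR (s * D w)).
  by apply/funext => w; congr expR; rewrite /s /D /W; field; rewrite gt_eqF.
have mD : measurable_fun setT D by exact: measurable_funB.
have iD : P.-integrable setT (EFin \o D).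
  exact: (integrableB measurableT iW (finite_measure_integrable_cst P mu measurableT)).
apply: (@le_trans _ _ (1 + chernoff_const * (l * b) ^+ 2)%:E); last first.
  by rewrite lee_fin expR_ge1Dx.
have k0 : 0 <= 16 * s ^+ 2 * expR chi_bound.
  by rewrite mulr_ge0 ?expR_ge0// mulr_ge0// sqr_ge0.
apply: (@expectation_le_centered _ _ _ _ _ (fun w => s * D w)
   (fun w => 16 * s ^+ 2 * expR chi_bound * expR (W w))) => //.
- by apply: measurableT_comp => //; exact: measurable_funM.
- exact: (integrableZl measurableT s iD).
- rewrite unlock; under eq_integral do rewrite EFinM.
  rewrite integralZl//; under eq_integral do rewrite EFinB.
  rewrite integralB//; last exact: finite_measure_integrable_cst.
  move: muE; rewrite unlock => ->.
  by rewrite integral_cst//= probability_setT mule1 subee// mule0.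
- exact: measurable_funM.
- by move=> w /=; rewrite mulr_ge0 ?expR_ge0.
- rewrite ge0_expectationZl//.
  have -> : chernoff_const * (l * b) ^+ 2 =
      16 * s ^+ 2 * expR chi_bound * chi_bound.
    by rewrite /chernoff_const /s; ring.
  rewrite [leRHS]EFinM; apply: lee_wpmul2l => //.
- move=> w; apply: le_trans (expR_le_quadratic _) _; rewrite lerD2l.
  have D2 : D w ^+ 2 <= 16 * expR (`|D w| / 2).
    have := sqr_le_expR (D w / 2); rewrite normrM [`|2^-1|]ger0_norm//.
    by rewrite expr_div_n; lra.
  have sD : `|s * D w| <= `|D w| / 2.
    by rewrite normrM mulrC ler_wpM2l.
  have aD : `|D w| <= chi_bound + W w.
    by have := W0 w; rewrite ler_norml /D; move=> w0; apply/andP; split; lra.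
  rewrite exprMn -[leLHS]mulrA [leRHS](_ : _ = s ^+ 2 * (16 * (expR chi_bound * expR (W w)))).
    apply: ler_wpM2l; first exact: sqr_ge0.
  apply: (@le_trans _ _ (16 * expR (`|D w| / 2) * expR (`|D w| / 2))).
    by apply: ler_pM => //; rewrite ?sqr_ge0 ?expR_ge0 ?ler_expR.
    by rewrite -mulrA -!expRD ler_pM2l// ler_expR; lra.
  by ring.
Qed.

End subgaussian_square.

Lemma lee_prod_expR {R : realType} (I : finType) (F : I -> \bar R) (c : I -> R) :
  (forall i, 0 <= F i)%E -> (forall i, F i <= (expR (c i))%:E)%E ->
  (\prod_i F i <= (expR (\sum_i c i))%:E)%E.
Proof.
move=> F0 FG.
(* Nonnegativity is carried through the induction, because upper bounds multiply only for
   nonnegative factors. *)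
suff [] : (0 <= \prod_i F i /\ \prod_i F i <= (expR (\sum_i c i))%:E)%E by [].
apply: (big_ind2 (fun (x : \bar R) y => 0 <= x /\ x <= (expR y)%:E)%E) => //.
- by rewrite expR0.
- move=> x y x' y' [x0 xy] [x0' xy']; split; first exact: mule_ge0.
  by rewrite expRD EFinM; exact: lee_pmul.
Qed.

(** * Exponential moments of linear and quadratic forms in independent entries *)

Section quadratic_form.
Context d (T : measurableType d) (R : realType) (P : probability T R).
Variables (p1 p2 : nat) (Z : 'I_p1 -> 'I_p2 -> T -> R) (b : 'I_p2 -> R).
Hypothesis b0 : forall j, 0 < b j.
Hypothesis mZ : forall i j, measurable_fun setT (Z i j).
Hypothesis indZ : mutually_independent P (fun ij : 'I_p1 * 'I_p2 => Z ij.1 ij.2).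
Hypothesis sgZ : forall i j t,
  ('E_P[fun w => expR (t * Z i j w)] <= (expR (b j * t ^+ 2))%:E)%E.
Variable z : 'I_p1 -> R.

Let X (ij : 'I_p1 * 'I_p2) : T -> R := Z ij.1 ij.2.

Lemma expectation_expR_lincomb j t :
  ('E_P[fun w => expR (t * \sum_i z i * Z i j w)] <=
   (expR (b j * (\sum_i z i ^+ 2) * t ^+ 2))%:E)%E.
Proof.
(* The product runs over all entries of the matrix, with factor 1 outside column [j], so that
   independence of the whole family applies directly. *)
pose g ij w : R := expR (if ij.2 == j then t * z ij.1 * X ij w else 0).
have -> : (fun w => expR (t * \sum_i z i * Z i j w)) = (fun w => \prod_ij g ij w).
  apply/funext => w; rewrite /g -expR_sum; congr expR.
  rewrite -(pair_bigA _ (fun i k => if k == j then t * z i * Z i k w else 0))/=.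
  rewrite mulr_sumr; apply: eq_bigr => i _.
  by rewrite -big_mkcond/= big_pred1_eq mulrA.
rewrite (@expectation_prod_indep _ _ _ _ X P (fun ij => mZ ij.1 ij.2) indZ _ id); last 2 first.
- move=> ij; rewrite /g; case: (ij.2 == j) => //; apply: measurableT_comp => //.
  by apply: measurable_funM => //; apply: measurable_fun_cylinders; rewrite inE.
- by move=> j' w; exact: expR_ge0.
apply: le_trans (lee_prod_expR (c := fun ij : 'I_p1 * 'I_p2 =>
    if ij.2 == j then b j * (t * z ij.1) ^+ 2 else 0) _ _) _.
- by move=> ij; apply: expectation_ge0 => w; exact: expR_ge0.
- move=> [i k]; rewrite /g/=; case: eqP => [->|_]; first exact: sgZ.
  by rewrite expectation_cst.
- rewrite -(pair_bigA _ (fun i k => if k == j then b j * (t * z i) ^+ 2 else 0))/=.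
  rewrite lee_fin ler_expR [leRHS]mulrAC mulr_sumr le_eqVlt; apply/orP; left; apply/eqP.
  apply: eq_bigr => i _.
  by rewrite -big_mkcond/= big_pred1_eq exprMn mulrA.
Qed.

Lemma expectation_expR_quadratic_form (l : R) :
  \sum_i z i ^+ 2 <= 4 -> (forall j, `|l| * (4 * b j) <= 16^-1) ->
  ('E_P[fun w => expR (l * \sum_j ((\sum_i z i * Z i j w) ^+ 2 -
      fine 'E_P[fun w => ((\sum_i z i * Z i j w) ^+ 2)%R]%E))]
   <= (expR (chernoff_const * (16 * l ^+ 2 * \sum_j b j ^+ 2)))%:E)%E.
Proof.
move=> z4 lb.
pose g j w : R := expR (l * ((\sum_i z i * Z i j w) ^+ 2 -
  fine 'E_P[fun w => ((\sum_i z i * Z i j w) ^+ 2)%R]%E)).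
have -> : (fun w => expR (l * \sum_j ((\sum_i z i * Z i j w) ^+ 2 -
    fine 'E_P[fun w => ((\sum_i z i * Z i j w) ^+ 2)%R]%E))) = (fun w => \prod_j g j w).
  by apply/funext => w; rewrite /g -expR_sum mulr_sumr.
(* The blocks are the columns. Since [|z|^2 <= 4], the linear form in column [j] has variance proxy
   [4 * b j]. *)
rewrite (@expectation_prod_indep _ _ _ _ X P (fun ij => mZ ij.1 ij.2) indZ _ snd); last 2 first.
- move=> j; apply: measurableT_comp => //; apply: measurable_funM => //.
  apply: measurable_funB => //; apply: measurable_funX; apply: measurable_sum => i.
  apply: measurable_funM => //.
  by apply: (@measurable_fun_cylinders _ _ _ _ X _ (i, j)); rewrite inE.
- by move=> j' w; exact: expR_ge0.
apply: le_trans (lee_prod_expR (c := fun j => chernoff_const * (l * (4 * b j)) ^+ 2) _ _) _.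
- by move=> j; apply: expectation_ge0 => w; exact: expR_ge0.
- move=> j; apply: expectation_expR_centered_sqr => //.
  + by rewrite mulr_gt0.
  + by apply: measurable_sum => i; apply: measurable_funM.
  + move=> t; apply: le_trans (expectation_expR_lincomb j t) _.
    rewrite lee_fin ler_expR ler_wpM2r ?sqr_ge0// mulrC ler_wpM2r//.
    exact: ltW.
- rewrite lee_fin ler_expR -mulr_sumr; apply: ler_wpM2l; first exact: chernoff_const_ge0.
  rewrite mulr_sumr le_eqVlt; apply/orP; left; apply/eqP.
  by apply: eq_bigr => j _; ring.
Qed.

End quadratic_form.

(** * The spectral norm and a lattice net *)

Section spectral_norm.
Context {R : realType}.

Definition dot {n} (u v : 'cV[R]_n) : R := \sum_i u i ord0 * v i ord0.

Lemma dotDl n (u v w : 'cV[R]_n) : dot (u + v) w = dot u w + dot v w.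
Proof. by rewrite /dot -big_split; apply: eq_bigr => i _; rewrite mxE mulrDl. Qed.

Lemma dotDr n (u v w : 'cV[R]_n) : dot w (u + v) = dot w u + dot w v.
Proof. by rewrite /dot -big_split; apply: eq_bigr => i _; rewrite mxE mulrDr. Qed.

Lemma dotZl n a (u v : 'cV[R]_n) : dot (a *: u) v = a * dot u v.
Proof. by rewrite /dot mulr_sumr; apply: eq_bigr => i _; rewrite mxE mulrA. Qed.

Lemma dotNl n (u v : 'cV[R]_n) : dot (- u) v = - dot u v.
Proof. by rewrite -scaleN1r dotZl mulN1r. Qed.

Lemma dotNr n (u v : 'cV[R]_n) : dot u (- v) = - dot u v.
Proof. by rewrite /dot -sumrN; apply: eq_bigr => i _; rewrite mxE mulrN. Qed.

Lemma vnorm2_ge0 n (u : 'cV[R]_n) : 0 <= vnorm2 u.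
Proof. exact: sqrtr_ge0. Qed.

Lemma vnorm2_sqr n (u : 'cV[R]_n) : vnorm2 u ^+ 2 = \sum_i u i ord0 ^+ 2.
Proof. by rewrite sqr_sqrtr// sumr_ge0// => i _; exact: sqr_ge0. Qed.

Lemma dot_sqr n (u : 'cV[R]_n) : dot u u = vnorm2 u ^+ 2.
Proof. by rewrite vnorm2_sqr; apply: eq_bigr => i _; rewrite expr2. Qed.

Lemma vnorm2_le n (u : 'cV[R]_n) c : 0 <= c -> \sum_i u i ord0 ^+ 2 <= c ^+ 2 ->
  vnorm2 u <= c.
Proof. by move=> c0 h; rewrite -(ger0_norm c0) -sqrtr_sqr ler_wsqrtr. Qed.

Lemma vnorm2Z n a (u : 'cV[R]_n) : vnorm2 (a *: u) = `|a| * vnorm2 u.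
Proof.
rewrite /vnorm2 -sqrtr_sqr -sqrtrM ?sqr_ge0// mulr_sumr; congr Num.sqrt.
by apply: eq_bigr => i _; rewrite mxE exprMn.
Qed.

(** Cauchy-Schwarz, from the identity [U^2 (U^2 V^2 - D^2) = sum_i (D u_i - U^2 v_i)^2] with
    [D = dot u v], where [U] and [V] are the two norms. *)
Lemma dot_le n (u v : 'cV[R]_n) : dot u v <= vnorm2 u * vnorm2 v.
Proof.
have [u0|un0] := eqVneq (vnorm2 u) 0.
  rewrite u0 mul0r /dot big1// => i _; apply/eqP; rewrite mulf_eq0 -(sqrf_eq0 (u i ord0)).
  have /psumr_eq0P : \sum_i u i ord0 ^+ 2 = 0 by rewrite -vnorm2_sqr u0 expr0n.
  by move=> ->//; rewrite ?eqxx// => k _; exact: sqr_ge0.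
have U0 : 0 < vnorm2 u by rewrite lt_neqAle eq_sym un0 vnorm2_ge0.
set U := vnorm2 u in U0 *; set V := vnorm2 v; have V0 : 0 <= V by exact: vnorm2_ge0.
suff : 0 <= U ^+ 2 * (U ^+ 2 * V ^+ 2 - dot u v ^+ 2).
  rewrite pmulr_rge0 ?exprn_gt0// subr_ge0 -exprMn.
  have UV0 : 0 <= U * V by rewrite mulr_ge0// ltW.
  have [D0|D0] := leP (dot u v) 0; first by move=> _; exact: le_trans D0 UV0.
  by rewrite ler_pXn2r// nnegrE ltW.
have -> : U ^+ 2 * (U ^+ 2 * V ^+ 2 - dot u v ^+ 2) =
    \sum_i (dot u v * u i ord0 - U ^+ 2 * v i ord0) ^+ 2.
  set D := dot u v.
  transitivity (\sum_i (D ^+ 2 * u i ord0 ^+ 2 +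
      (- (2 * D * U ^+ 2) * (u i ord0 * v i ord0) + U ^+ 2 ^+ 2 * v i ord0 ^+ 2))).
    rewrite !big_split/= -!mulr_sumr -!vnorm2_sqr -/U -/V -/(dot u v) -/D; ring.
  by apply: eq_bigr => i _; ring.
by apply: sumr_ge0 => i _; exact: sqr_ge0.
Qed.

(** The Frobenius norm is an upper bound, by Cauchy-Schwarz in each row. Hence the [sup] in
    [specnorm] is a true supremum and not a default value. *)
Lemma specnorm_has_sup m n (A : 'M[R]_(m, n)) :
  has_sup [set vnorm2 (A *m v) | v in [set v : 'cV[R]_n | vnorm2 v <= 1]].
Proof.
split.
  exists (vnorm2 (A *m (0 : 'cV_n))), 0 => //=.
  by apply: vnorm2_le => //; rewrite big1// => i _; rewrite mxE expr0n.
pose F := \sum_i vnorm2 (row i A)^T ^+ 2.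
have F0 : 0 <= F by apply: sumr_ge0 => i _; exact: sqr_ge0.
exists (Num.sqrt F) => _ [v /= v1 <-]; apply: ler_wsqrtr; apply: ler_sum => i _.
have AvE : (A *m v) i ord0 = dot (row i A)^T v.
  by rewrite mxE; apply: eq_bigr => k _; rewrite !mxE.
rewrite AvE; have h1 := dot_le (row i A)^T v; have h2 := dot_le (- 1 *: (row i A)^T) v.
move: h2; rewrite dotZl vnorm2Z normrN normr1 mul1r mulN1r => h2.
have v0 := vnorm2_ge0 v; have w0 := vnorm2_ge0 (row i A)^T.
have hv : vnorm2 (row i A)^T * vnorm2 v <= vnorm2 (row i A)^T by rewrite ler_piMr.
by rewrite -real_normK ?num_real// ler_pXn2r ?nnegrE// ler_norml; apply/andP; split; lra.
Qed.

Lemma specnorm_ge0 m n (A : 'M[R]_(m, n)) : 0 <= specnorm A.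
Proof.
apply: le_trans (vnorm2_ge0 (A *m 0)) _; apply: sup_upper_bound.
  exact: specnorm_has_sup.
exists 0 => //=; apply: vnorm2_le => //; rewrite big1// => i _.
by rewrite mxE expr0n.
Qed.

Lemma specnorm_le m n (A : 'M[R]_(m, n)) c :
  (forall v : 'cV_n, vnorm2 v <= 1 -> vnorm2 (A *m v) <= c) -> specnorm A <= c.
Proof.
move=> h; apply: ge_sup; first by case: (specnorm_has_sup A).
by move=> _ [v v1 <-]; exact: h.
Qed.

(** Rescaling by a positive upper bound [c] instead of by the norm of [v] avoids a separate case
    [v = 0]. *)
Lemma vnorm2_mul_le m n (A : 'M[R]_(m, n)) (v : 'cV_n) c : 0 < c -> vnorm2 v <= c ->
  vnorm2 (A *m v) <= specnorm A * c.
Proof.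
move=> c0 vc; have -> : v = c *: (c^-1 *: v) by rewrite scalerA mulfV ?gt_eqF// scale1r.
rewrite -scalemxAr vnorm2Z gtr0_norm//.
rewrite [leLHS]mulrC ler_pM2r//.
apply: sup_upper_bound; first exact: specnorm_has_sup.
exists (c^-1 *: v) => //=.
by rewrite vnorm2Z gtr0_norm ?invr_gt0// mulrC ler_pdivrMr// mul1r.
Qed.

(* A lattice vector of mesh [1 / (4 sqrt p)], given in sign-magnitude form; the
   two encodings of zero are harmless, since the net is only counted from above. *)
Definition lattice_vec {p} (k : {ffun 'I_p -> bool * 'I_(4 * p).+1}) : 'cV[R]_p :=
  \col_i ((-1) ^+ (k i).1 * (k i).2%:R / (4 * Num.sqrt p%:R)).

(** With squared mesh [1 / (16 p)], this integer condition states that the lattice vector lies in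
    the unit ball. *)
Definition lattice_net p : {pred {ffun 'I_p -> bool * 'I_(4 * p).+1}} :=
  [pred k : {ffun 'I_p -> bool * 'I_(4 * p).+1} | (\sum_i (k i).2 ^ 2 <= 16 * p)%N].
Global Arguments lattice_net : clear implicits.

Lemma lattice_vec_norm p k : (0 < p)%N -> k \in lattice_net p ->
  vnorm2 (lattice_vec k) <= 1.
Proof.
move=> p0; rewrite inE => kN; apply: vnorm2_le => //.
have P0 : 0 < p%:R :> R by rewrite ltr0n.
under eq_bigr => i _ do
  rewrite mxE !exprMn sqrr_sign mul1r exprVn exprMn sqr_sqrtr ?ler0n// -natrX.
rewrite -mulr_suml -natr_sum ler_pdivrMr ?mulr_gt0 ?exprn_gt0// expr1n mul1r.
by rewrite -natrX -natrM ler_nat.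
Qed.

(** Each coordinate is rounded towards zero, which keeps the vector in the unit ball. The coordinate
    errors are at most [1 / h] with [h^2 = 16 p], so the squared error is at most
    [p / (16 p) = 1/16]. *)
Lemma lattice_net_cover p (u : 'cV[R]_p) : (0 < p)%N -> vnorm2 u <= 1 ->
  exists2 k, k \in lattice_net p & vnorm2 (u - lattice_vec k) <= 4^-1.
Proof.
move=> p0 u1.
have P0 : 0 < p%:R :> R by rewrite ltr0n.
pose h : R := 4 * Num.sqrt p%:R.
have h0 : 0 < h by rewrite mulr_gt0// sqrtr_gt0.
have h2 : h ^+ 2 = 16 * p%:R by rewrite exprMn sqr_sqrtr ?ler0n// -natrX.
have usum : \sum_i u i ord0 ^+ 2 <= 1.
  by rewrite -vnorm2_sqr expr_le1 ?vnorm2_ge0.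
have ui i : u i ord0 ^+ 2 <= 1.
  apply: le_trans usum; rewrite (bigD1 i)//= lerDl sumr_ge0// => k _.
  exact: sqr_ge0.
pose n i := Num.truncn (h * `|u i ord0|).
have nP i : (n i)%:R <= h * `|u i ord0| < (n i).+1%:R.
  by apply: truncn_itv; rewrite mulr_ge0// ltW.
have n2 i : (n i)%:R ^+ 2 <= h ^+ 2 * u i ord0 ^+ 2.
  have /andP[nl _] := nP i; rewrite -(real_normK (num_real (u i ord0))) -exprMn.
  by rewrite !expr2; apply: ler_pM => //; exact: ler0n.
(* The range [4 p] of magnitudes suffices because [n i <= 4 sqrt p <= 4 p]. *)
have nb i : (n i < (4 * p).+1)%N.
  rewrite ltnS -(@ler_nat R) -(@ler_pXn2r _ 2)// ?nnegrE//.
  apply: (le_trans (n2 i)); rewrite h2 natrM.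
  have : (1 : R) <= p%:R by rewrite ler1n.
  by have := ui i; have := sqr_ge0 (u i ord0); nra.
pose k : {ffun 'I_p -> bool * 'I_(4 * p).+1} :=
  [ffun i => (u i ord0 < 0, Ordinal (nb i))].
exists k.
  rewrite inE -(@ler_nat R) natr_sum.
  apply: (@le_trans _ _ (\sum_i h ^+ 2 * u i ord0 ^+ 2)).
    by apply: ler_sum => i _; rewrite ffunE natrX; exact: n2.
  by rewrite -mulr_sumr h2 natrM ler_piMr// mulr_ge0.
apply: vnorm2_le => //.
apply: (@le_trans _ _ (\sum_(i < p) (h ^+ 2)^-1)).
  apply: ler_sum => i _; rewrite !mxE ffunE/= -/h.
  have uE : u i ord0 = (-1) ^+ (u i ord0 < 0)%R * `|u i ord0|.
    by rewrite [LHS]realEsign ?num_real.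
  rewrite [X in X - _]uE -mulrA -mulrBr exprMn sqrr_sign mul1r.
  have -> : `|u i ord0| - (n i)%:R / h = (h * `|u i ord0| - (n i)%:R) / h.
    by field; rewrite gt_eqF.
  rewrite exprMn exprVn ler_piMl// ?invr_ge0 ?sqr_ge0//.
  by have := nP i; rewrite -natr1 => /andP[? ?]; rewrite expr_le1//; lra.
rewrite sumr_const card_ord h2 -mulr_natr le_eqVlt; apply/orP; left; apply/eqP.
by field; rewrite gt_eqF.
Qed.

(** Replacing each of the two unit vectors by a net point at distance at most 1/4 costs at most
    [S / 4]. Hence [S <= c + S / 2], which is solved for [S]. *)
Lemma specnorm_le_net p (A : 'M[R]_p) c : (0 < p)%N ->
  (forall k l, k \in lattice_net p -> l \in lattice_net p ->
    dot (lattice_vec k) (A *m lattice_vec l) <= c) ->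
  specnorm A <= 2 * c.
Proof.
move=> p0 hc; set S := specnorm A; have S0 : 0 <= S by exact: specnorm_ge0.
have N0 : vnorm2 (0 : 'cV[R]_p) <= 1.
  by apply: vnorm2_le => //; rewrite big1// => i _; rewrite mxE expr0n.
suff : S <= c + S / 2 by lra.
apply: specnorm_le => v v1.
have [l lN vl] := lattice_net_cover p0 v1.
have key u : vnorm2 u <= 1 -> dot u (A *m v) <= c + S / 2.
  move=> u1; have [k kN uk] := lattice_net_cover p0 u1.
  set x := lattice_vec k in uk *; set y := lattice_vec l in vl *.
  have -> : dot u (A *m v) = dot x (A *m y) + dot (u - x) (A *m v) + dot x (A *m (v - y)).
    have -> : dot u (A *m v) = dot x (A *m v) + dot (u - x) (A *m v).
      by rewrite -dotDl addrC subrK.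
    have -> : dot x (A *m v) = dot x (A *m y) + dot x (A *m (v - y)).
      by rewrite -dotDr -mulmxDr addrC subrK.
    by rewrite addrAC.
  have h1 : dot x (A *m y) <= c by exact: hc.
  have h2 : dot (u - x) (A *m v) <= 4^-1 * S.
    apply: le_trans (dot_le _ _) _; apply: ler_pM; rewrite ?vnorm2_ge0//.
    by rewrite -[leRHS]mulr1; exact: vnorm2_mul_le.
  have h3 : dot x (A *m (v - y)) <= 1 * (S * 4^-1).
    apply: le_trans (dot_le _ _) _; apply: ler_pM; rewrite ?vnorm2_ge0//.
      exact: lattice_vec_norm.
    exact: vnorm2_mul_le.
  by lra.
(* The bilinear bound is tested at [u = A v / |A v|]; if [A v] vanishes, the choice [u = 0] still
   yields [0 <= c + S / 2]. *)
have [Av0|Avn0] := eqVneq (vnorm2 (A *m v)) 0.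
  by have := key 0 N0; rewrite Av0 /dot big1// => i _; rewrite mxE mul0r.
have := key ((vnorm2 (A *m v))^-1 *: (A *m v)).
rewrite dotZl dot_sqr expr2 mulKf//; apply.
by rewrite vnorm2Z ger0_norm ?invr_ge0 ?vnorm2_ge0// mulVf.
Qed.

(** Every net point with magnitudes [n_i] satisfies [1 <= e^(16 p) prod_i e^(-n_i^2)]. Summed over
    all sign-magnitude vectors the right side factorises, and each coordinate contributes at most
    [4 <= e^2], whence [18 = 16 + 2]. *)
Lemma card_lattice_net p : (#|lattice_net p|%:R <= expR (18 * p%:R) :> R).
Proof.
rewrite -sum1_card natr_sum.
pose F (q : bool * 'I_(4 * p).+1) : R := expR (- (q.2%:R ^+ 2)).
apply: (@le_trans _ _ (\sum_(k : {ffun 'I_p -> bool * 'I_(4 * p).+1})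
    expR (16 * p%:R) * \prod_i F (k i))).
  rewrite [leLHS]big_mkcond/=; apply: ler_sum => k _.
  rewrite /F -expR_sum -expRD; case: ifPn => [|_]; last exact: expR_ge0.
  rewrite inE -(@ler_nat R) natrM natr_sum => h.
  rewrite -[leLHS]expR0 ler_expR sumrN subr_ge0.
  apply: le_trans h.
  by apply: ler_sum => i _; rewrite natrX.
rewrite -mulr_sumr -(bigA_distr_bigA (fun _ => F))/= prodr_const card_ord.
rewrite (_ : 18 * p%:R = 16 * p%:R + p%:R * 2); last by ring.
rewrite expRD ler_pM2l ?expR_gt0// expRM_natl.
have F0 : 0 <= \sum_q F q by apply: sumr_ge0 => q _; exact: expR_ge0.
rewrite lerXn2r ?nnegrE ?expR_ge0//.
have e2 : 2 <= expR 1 :> R by have := @expR_ge1Dx R 1; lra.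
apply: (@le_trans _ _ 4); last first.
  have -> : expR 2 = expR 1 * expR 1 :> R by rewrite -expRD; congr expR; lra.
  nra.
rewrite -(pair_bigA _ (fun (_ : bool) (m : 'I_(4 * p).+1) => expR (- (m%:R ^+ 2)) : R))/=.
rewrite sumr_const card_bool.
(* The two signs account for a factor 2; the magnitudes are compared with the geometric series of
   ratio 1/2. *)
suff : \sum_(m < (4 * p).+1) expR (- (m%:R ^+ 2)) <= 2 :> R by lra.
apply: (@le_trans _ _ (\sum_(m < (4 * p).+1) 2^-1 ^+ m)).
  apply: ler_sum => m _; rewrite expRN exprVn lef_pV2 ?posrE ?expR_gt0 ?exprn_gt0//.
  apply: (@le_trans _ _ (expR (m%:R * 1))).
    by rewrite expRM_natl lerXn2r ?nnegrE ?expR_ge0.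
  by rewrite ler_expR mulr1 -natrX ler_nat; case: (nat_of_ord m) => // n; rewrite leq_pmulr.
have := subrX1 (2^-1 : R) (4 * p).+1; set S := \sum_(_ < _) _.
have : 0 <= 2^-1 ^+ (4 * p).+1 :> R by rewrite exprn_ge0.
lra.
Qed.

End spectral_norm.

(** * Exponential moments of the centred Gram matrix *)

Section expectation_misc.
Context d (T : measurableType d) (R : realType) (P : probability T R).

(* No measurability is needed here, because the integral of a nonnegative
   function is a supremum over the simple functions below it. *)
Lemma ge0_expectation_le_nonmeasurable (f g : T -> R) :
  (forall w, 0 <= f w) -> (forall w, f w <= g w) -> ('E_P[f] <= 'E_P[g])%E.
Proof.
move=> f0 fg; have g0 w : 0 <= g w by exact: le_trans (fg w).
rewrite unlock !ge0_integralTE//; try by move=> w; rewrite lee_fin.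
apply: ereal_sup_le => _ [h hf <-]; exists h => // w.
by apply: le_trans (hf w) _; rewrite lee_fin.
Qed.

Lemma ge0_expectation_sum (I : Type) (r : seq I) (f : I -> T -> R) :
  (forall i, measurable_fun setT (f i)) -> (forall i w, 0 <= f i w) ->
  ('E_P[fun w => (\sum_(i <- r) f i w)%R] = \sum_(i <- r) 'E_P[f i])%E.
Proof.
move=> mf f0; rewrite unlock; under eq_integral do rewrite -sumEFin.
rewrite ge0_integral_sum// => i.
- exact/measurable_EFinP.
- by move=> w _; rewrite lee_fin.
Qed.

Lemma fine_expectation_sum (I : finType) (c : I -> R) (f : I -> T -> R) :
  (forall i, P.-integrable setT (EFin \o f i)) ->
  fine 'E_P[fun w => (\sum_i c i * f i w)%R]%E = \sum_i c i * fine 'E_P[f i]%E.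
Proof.
move=> intf; rewrite unlock; under eq_integral do rewrite -sumEFin.
rewrite (@integral_sum _ _ _ _ _ measurableT _ (fun i w => (c i * f i w)%:E)); last first.
  by move=> i; exact: (integrableZl measurableT (c i) (intf i)).
rewrite -sum_fine.
  apply: eq_bigr => i _; under eq_integral do rewrite EFinM.
  rewrite integralZl//; last exact: intf.
  by rewrite fineM//; apply: integrable_fin_num => //; exact: intf.
move=> i _; apply: integrable_fin_num => //.
exact: (integrableZl measurableT (c i) (intf i)).
Qed.

End expectation_misc.

Lemma vnorm2D_sqr {R : realType} n (x y : 'cV[R]_n) :
  vnorm2 x <= 1 -> vnorm2 y <= 1 -> \sum_i (x + y) i ord0 ^+ 2 <= 4.
Proof.
move=> x1 y1.
have -> : \sum_i (x + y) i ord0 ^+ 2 = dot (x + y) (x + y).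
  by apply: eq_bigr => i _; rewrite expr2.
rewrite dotDl !dotDr !dot_sqr.
have h1 := dot_le x y; have h2 := dot_le y x.
have x0 := vnorm2_ge0 x; have y0 := vnorm2_ge0 y; nra.
Qed.

Lemma expR_midpoint {R : realType} (u v : R) :
  expR ((u + v) / 2) <= (expR u + expR v) / 2.
Proof.
have eE (x : R) : expR x = expR (x / 2) ^+ 2 by rewrite -expRM_natl; congr expR; lra.
rewrite mulrDl expRD (eE u) (eE v).
have := sqr_ge0 (expR (u / 2) - expR (v / 2)); nra.
Qed.

Section core.
Context d (T : measurableType d) (R : realType) (P : probability T R).
Variables (p1 p2 : nat) (Z : 'I_p1 -> 'I_p2 -> T -> R) (b : 'I_p2 -> R).
Hypothesis b0 : forall j, 0 < b j.
Hypothesis mZ : forall i j, measurable_fun setT (Z i j).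
Hypothesis sgZ : forall i j t,
  ('E_P[fun w => expR (t * Z i j w)] <= (expR (b j * t ^+ 2))%:E)%E.

Definition centered_gram (w : T) : 'M[R]_p1 :=
  rmat Z w *m (rmat Z w)^T -
  \matrix_(i, k) fine ('E_P[fun w => (rmat Z w *m (rmat Z w)^T) i k])%E.

(** Domination by [Z_ij^2 + Z_kj^2]. Integrability makes the expectations under [fine] finite, so
    that [fine] commutes with finite sums in the computation of the quadratic form. *)
Lemma integrable_mul_entries i k j :
  P.-integrable setT (EFin \o (fun w => Z i j w * Z k j w)).
Proof.
have iZ2 l : P.-integrable setT (EFin \o (fun w => Z l j w ^+ 2)).
  have b8 : 8 * b j != 0 by rewrite mulf_neq0// gt_eqF.
  have := integrableZl measurableT (8 * b j) (integrable_sqr_subgaussian (b0 j) (mZ l j) (sgZ l j)).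
  apply: eq_integrable => // w _ /=.
  by rewrite -EFinM mulrC divfK.
apply: (@le_integrable _ _ _ _ _ measurableT _ _ _ _ (integrableD measurableT (iZ2 i) (iZ2 k))).
  by apply/measurable_EFinP; apply: measurable_funM.
move=> w _ /=; rewrite lee_fin [leRHS]ger0_norm ?addr_ge0 ?sqr_ge0//.
set x := Z i j w; set y := Z k j w.
have := sqr_ge0 (x - y); have := sqr_ge0 (x + y).
by have := sqr_ge0 x; have := sqr_ge0 y; rewrite ler_norml; move=> *; apply/andP; split; nra.
Qed.

Lemma dot_centered_gram (z : 'cV[R]_p1) w :
  dot z (centered_gram w *m z) =
  \sum_j ((\sum_i z i ord0 * Z i j w) ^+ 2 -
    fine 'E_P[fun w => ((\sum_i z i ord0 * Z i j w) ^+ 2)%R]%E).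
Proof.
have sqE j v : (\sum_i z i ord0 * Z i j v) ^+ 2 =
    \sum_(p : 'I_p1 * 'I_p1) (z p.1 ord0 * z p.2 ord0) * (Z p.1 j v * Z p.2 j v).
  rewrite -(pair_bigA _ (fun i k => (z i ord0 * z k ord0) * (Z i j v * Z k j v)))/=.
  rewrite expr2 mulr_suml; apply: eq_bigr => i _; rewrite mulr_sumr.
  by apply: eq_bigr => k _; rewrite mulrACA.
have gramE i k v : (rmat Z v *m (rmat Z v)^T) i k = \sum_j 1 * (Z i j v * Z k j v).
  by rewrite mxE; apply: eq_bigr => j _; rewrite !mxE mul1r.
have entryE i k : centered_gram w i k =
    \sum_j (Z i j w * Z k j w - fine 'E_P[fun v => (Z i j v * Z k j v)%R]%E).
  rewrite mxE gramE !mxE.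
  rewrite (_ : (fun v => _) = (fun v => \sum_j 1 * (Z i j v * Z k j v))); last first.
    by apply/funext => v; rewrite gramE.
  rewrite fine_expectation_sum; last by move=> j; exact: integrable_mul_entries.
  by rewrite -sumrB; apply: eq_bigr => j _; rewrite !mul1r.
have -> : dot z (centered_gram w *m z) = \sum_(p : 'I_p1 * 'I_p1) \sum_j
    (z p.1 ord0 * z p.2 ord0) * (Z p.1 j w * Z p.2 j w -
     fine 'E_P[fun v => (Z p.1 j v * Z p.2 j v)%R]%E).
  rewrite -(pair_bigA _ (fun i k => \sum_j (z i ord0 * z k ord0) * (Z i j w * Z k j w -
     fine 'E_P[fun v => (Z i j v * Z k j v)%R]%E)))/=.
  apply: eq_bigr => i _; rewrite mxE mulr_sumr; apply: eq_bigr => k _.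
  by rewrite entryE -mulr_sumr; ring.
rewrite exchange_big; apply: eq_bigr => j _.
rewrite sqE (_ : (fun v => _) = (fun v => \sum_(p : 'I_p1 * 'I_p1)
    (z p.1 ord0 * z p.2 ord0) * (Z p.1 j v * Z p.2 j v))); last first.
  by apply/funext => v; rewrite sqE.
rewrite fine_expectation_sum; last by move=> p; exact: integrable_mul_entries.
by rewrite -sumrB; apply: eq_bigr => p _; rewrite mulrBr.
Qed.

Lemma centered_gram_sym (x y : 'cV[R]_p1) w :
  dot y (centered_gram w *m x) = dot x (centered_gram w *m y).
Proof.
have sym i k : centered_gram w i k = centered_gram w k i.
  rewrite !mxE; congr (_ - _); first by apply: eq_bigr => j _; rewrite !mxE mulrC.
  congr fine; congr expectation; apply/funext => v.
  by rewrite !mxE; apply: eq_bigr => j _; rewrite !mxE mulrC.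
rewrite /dot; under eq_bigr do rewrite mxE mulr_sumr.
under [RHS]eq_bigr do rewrite mxE mulr_sumr.
rewrite exchange_big; apply: eq_bigr => i _; apply: eq_bigr => k _.
by rewrite [in LHS]sym; ring.
Qed.

(* Polarisation reduces the bilinear form on the net to quadratic forms; the
   maximum over the net is then linearised by [u <= s + expR (u - s)]. *)
Lemma specnorm_centered_gram_le (l s : R) w : (0 < p1)%N -> 0 < l ->
  specnorm (centered_gram w) <= 2 / l * (s + expR (- s) *
    \sum_(kk <- enum [predX lattice_net p1 & lattice_net p1])
     (expR (l / 2 * dot (lattice_vec kk.1 + lattice_vec kk.2)
        (centered_gram w *m (lattice_vec kk.1 + lattice_vec kk.2))) +
      expR (- (l / 2) * dot (lattice_vec kk.1 - lattice_vec kk.2)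
        (centered_gram w *m (lattice_vec kk.1 - lattice_vec kk.2)))) / 2).
Proof.
move=> p0 l0; rewrite mulrAC -mulrA.
rewrite big_enum/=; set S := \sum_(kk in _) _.
rewrite [leRHS](_ : _ = 2 * (l^-1 * (s + expR (- s) * S))); last by ring.
apply: specnorm_le_net => // k k' kN kN'.
set x := lattice_vec k; set y := lattice_vec k'; set A := centered_gram w.
rewrite mulrC ler_pdivlMr// mulrC.
pose u := l / 2 * dot (x + y) (A *m (x + y)).
pose v := - (l / 2) * dot (x - y) (A *m (x - y)).
have -> : l * dot x (A *m y) = (u + v) / 2.
  rewrite /u /v !mulmxDr mulmxN !dotDl !dotDr !dotNl !dotNr (centered_gram_sym x y) -/A.
  by field.
have h1 : (u + v) / 2 <= s + expR (- s) * expR ((u + v) / 2).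
  by rewrite -expRD; have := le_expR (- s + (u + v) / 2); lra.
apply: (le_trans h1); rewrite lerD2l ler_pM2l ?expR_gt0//.
apply: (le_trans (expR_midpoint u v)).
rewrite /S (bigD1 (k, k'))/=; last by rewrite inE/= kN kN'.
rewrite lerDl; apply: sumr_ge0 => kk _.
by apply: divr_ge0 => //; apply: addr_ge0; exact: expR_ge0.
Qed.

End core.

(** * The expected spectral norm for positive variance proxies *)

Definition gram_const {R : realType} : R := 64 * (37 + chernoff_const).

Section expected_norm.
Context d (T : measurableType d) (R : realType) (P : probability T R).
Variables (p1 p2 : nat) (Z : 'I_p1 -> 'I_p2 -> T -> R) (b : 'I_p2 -> R) (m : R).
Hypothesis b0 : forall j, 0 < b j.
Hypotheses (m0 : 0 < m) (bm : forall j, b j <= m).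
Hypothesis mZ : forall i j, measurable_fun setT (Z i j).
Hypothesis indZ : mutually_independent P (fun ij : 'I_p1 * 'I_p2 => Z ij.1 ij.2).
Hypothesis sgZ : forall i j t,
  ('E_P[fun w => expR (t * Z i j w)] <= (expR (b j * t ^+ 2))%:E)%E.

Lemma measurable_expR_dot_centered_gram (l : R) (z : 'cV[R]_p1) :
  measurable_fun setT (fun w => expR (l * dot z (centered_gram P Z w *m z))).
Proof.
apply: measurableT_comp => //; apply: measurable_funM => //.
under eq_fun do rewrite (dot_centered_gram b0 mZ sgZ).
apply: measurable_sum => j; apply: measurable_funB => //; apply: measurable_funX.
by apply: measurable_sum => i; apply: measurable_funM.
Qed.

Lemma expectation_expR_dot_centered_gram (l : R) (z : 'cV[R]_p1) :
  \sum_i z i ord0 ^+ 2 <= 4 -> `|l| * m <= 64^-1 ->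
  ('E_P[fun w => expR (l * dot z (centered_gram P Z w *m z))]
   <= (expR (chernoff_const * (16 * l ^+ 2 * \sum_j b j ^+ 2)))%:E)%E.
Proof.
move=> z4 lm.
rewrite (_ : (fun w => _) = fun w => expR (l * \sum_j ((\sum_i z i ord0 * Z i j w) ^+ 2 -
    fine 'E_P[fun w => ((\sum_i z i ord0 * Z i j w) ^+ 2)%R]%E))); last first.
  by apply/funext => w; rewrite (dot_centered_gram b0 mZ sgZ).
apply: (expectation_expR_quadratic_form b0 mZ indZ sgZ z4) => j.
(* The threshold 1/64 is the Bernstein range 1/16 divided by the factor 4 in the proxy [4 * b j]. *)
have : `|l| * b j <= `|l| * m by rewrite ler_wpM2l.
lra.
Qed.

Lemma expectation_specnorm_centered_gram :
  ('E_P[fun w => specnorm (centered_gram P Z w)] <=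
   (gram_const * (Num.sqrt (p1%:R * \sum_j b j ^+ 2) + p1%:R * m))%:E)%E.
Proof.
set V := Num.sqrt _ + _.
have C0 : 0 <= chernoff_const :> R := chernoff_const_ge0.
(* With no rows the norm is 0; this case is separate because the parameter [l] below would
   vanish. *)
have [p10|p0] := posnP p1.
  apply: (@le_trans _ _ ('E_P[cst 0%R])%E).
    apply: ge0_expectation_le_nonmeasurable => w; first exact: specnorm_ge0.
    apply: specnorm_le => v _; apply: vnorm2_le => //.
    by rewrite /= expr0n big1// => i; have := ltn_ord i; rewrite [X in (_ < X)%N]p10.
  rewrite expectation_cst lee_fin; apply: mulr_ge0.
    by apply: mulr_ge0 => //; apply: addr_ge0.
  by apply: addr_ge0; [exact: sqrtr_ge0|rewrite mulr_ge0// ltW].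
have P1 : 1 <= p1%:R :> R by rewrite ler1n.
have P0 : 0 < p1%:R :> R by lra.
have pm0 : 0 < p1%:R * m by exact: mulr_gt0.
have B0 : 0 <= \sum_j b j ^+ 2 by apply: sumr_ge0 => j _; exact: sqr_ge0.
have q0 : 0 <= Num.sqrt (p1%:R * \sum_j b j ^+ 2) by exact: sqrtr_ge0.
have V0 : 0 < V by rewrite /V; lra.
have VB : p1%:R * \sum_j b j ^+ 2 <= V ^+ 2.
  rewrite -[leLHS]sqr_sqrtr ?mulr_ge0 ?(ltW P0)//.
  by rewrite /V; nra.
(* The summand [p1 * m] of [V] keeps [l / 2] in the Bernstein range, and the square-root summand
   keeps the exponent [16 (l/2)^2 sum_j b_j^2] below [p1]. *)
pose l := p1%:R / (32 * V); have l0 : 0 < l by rewrite divr_gt0// mulr_gt0.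
(* The shift cancels the logarithm of the sum over pairs of net points: [36 = 2 * 18] for the two
   nets and [chernoff_const] for each moment. What remains is [s + 1 <= (37 + chernoff_const) * p1],
   and with [2 / l = 64 V / p1] this gives [gram_const]. *)
pose s : R := (36 + chernoff_const) * p1%:R.
have lm : l / 2 * m <= 64^-1.
  have -> : l / 2 * m = 64^-1 * (p1%:R * m / V) by rewrite /l; field; rewrite gt_eqF.
  by rewrite ler_piMr// ler_pdivrMr// mul1r /V; lra.
have lB : 16 * (l / 2) ^+ 2 * \sum_j b j ^+ 2 <= p1%:R.
  have -> : 16 * (l / 2) ^+ 2 * \sum_j b j ^+ 2 =
      256^-1 * (p1%:R * (p1%:R * (\sum_j b j ^+ 2) / V ^+ 2)).
    rewrite /l; move: (V) (\sum_j b j ^+ 2) (p1%:R : R) V0 => v B q v0.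
    by field; rewrite gt_eqF.
  have : p1%:R * (\sum_j b j ^+ 2) / V ^+ 2 <= 1 by rewrite ler_pdivrMr ?exprn_gt0// mul1r.
  set q := _ / _ => q1; have : p1%:R * q <= p1%:R by rewrite ler_piMr// ltW.
  lra.
pose E w := fun kk => (expR (l / 2 * dot (lattice_vec kk.1 + lattice_vec kk.2)
        (centered_gram P Z w *m (lattice_vec kk.1 + lattice_vec kk.2))) +
      expR (- (l / 2) * dot (lattice_vec kk.1 - lattice_vec kk.2)
        (centered_gram P Z w *m (lattice_vec kk.1 - lattice_vec kk.2)))) / 2.
have mE kk : measurable_fun setT (E ^~ kk).
  apply: measurable_funM => //; apply: measurable_funD;
  exact: measurable_expR_dot_centered_gram.
have E0 w kk : 0 <= E w kk.
  by apply: divr_ge0 => //; apply: addr_ge0; exact: expR_ge0.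
have EE kk : kk \in [predX lattice_net p1 & lattice_net p1] ->
    ('E_P[E ^~ kk] <= (expR (chernoff_const * p1%:R))%:E)%E.
  move=> /andP[k1 k2].
  have n1 : vnorm2 (lattice_vec kk.1) <= 1 :> R by exact: lattice_vec_norm.
  have n2 : vnorm2 (lattice_vec kk.2) <= 1 :> R by exact: lattice_vec_norm.
  have n2' : vnorm2 (- lattice_vec kk.2) <= 1 :> R.
    by rewrite -scaleN1r vnorm2Z normrN1 mul1r.
  have eb : (expR (chernoff_const * (16 * (l / 2) ^+ 2 * \sum_j b j ^+ 2)) <=
      expR (chernoff_const * p1%:R) :> R).
    by rewrite ler_expR ler_wpM2l.
  rewrite (_ : E ^~ kk = fun w => 2^-1 * (2 * E w kk)); last first.
    by apply/funext => w; rewrite mulKf.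
  rewrite ge0_expectationZl//; [|exact: measurable_funM|by move=> w; exact: mulr_ge0].
  rewrite (_ : (fun w => 2 * E w kk) = fun w =>
      expR (l / 2 * dot (lattice_vec kk.1 + lattice_vec kk.2)
        (centered_gram P Z w *m (lattice_vec kk.1 + lattice_vec kk.2))) +
      expR (- (l / 2) * dot (lattice_vec kk.1 - lattice_vec kk.2)
        (centered_gram P Z w *m (lattice_vec kk.1 - lattice_vec kk.2)))); last first.
    by apply/funext => w; rewrite /E mulrC divfK.
  rewrite ge0_expectationD; [|exact: measurable_expR_dot_centered_gram
    |exact: measurable_expR_dot_centered_gram|by move=> w; exact: expR_ge0
    |by move=> w; exact: expR_ge0].
  rewrite (_ : expR (chernoff_const * p1%:R) =
    2^-1 * (expR (chernoff_const * p1%:R) + expR (chernoff_const * p1%:R))); last by field.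
  rewrite EFinM; apply: lee_wpmul2l; first by rewrite lee_fin.
  have l20 : 0 < l / 2 by rewrite divr_gt0.
  rewrite EFinD; apply: leeD.
    apply: le_trans (expectation_expR_dot_centered_gram _ _) _.
    - exact: vnorm2D_sqr.
    - by rewrite gtr0_norm.
    - by rewrite lee_fin.
  apply: le_trans (expectation_expR_dot_centered_gram _ _) _.
  - exact: vnorm2D_sqr.
  - by rewrite normrN gtr0_norm.
  - by rewrite lee_fin sqrrN.
have mS : measurable_fun setT
    (fun w => \sum_(kk <- enum [predX lattice_net p1 & lattice_net p1]) E w kk).
  exact: measurable_sum.
have S0 w : 0 <= \sum_(kk <- enum [predX lattice_net p1 & lattice_net p1]) E w kk.
  exact: sumr_ge0.
have s0 : 0 <= s by apply: mulr_ge0; [apply: addr_ge0|exact: ltW].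
apply: (@le_trans _ _ ('E_P[fun w => (2 / l * (s + expR (- s) *
    \sum_(kk <- enum [predX lattice_net p1 & lattice_net p1]) E w kk))%R])%E).
  apply: ge0_expectation_le_nonmeasurable => w; first exact: specnorm_ge0.
  exact: (specnorm_centered_gram_le P Z s w p0 l0).
have m1 : measurable_fun setT (fun w => expR (- s) *
    \sum_(kk <- enum [predX lattice_net p1 & lattice_net p1]) E w kk).
  exact: measurable_funM.
have p1S w : 0 <= expR (- s) *
    \sum_(kk <- enum [predX lattice_net p1 & lattice_net p1]) E w kk.
  by apply: mulr_ge0 => //; exact: expR_ge0.
rewrite ge0_expectationZl; [|exact: measurable_funD|by rewrite divr_ge0// ltW
  |by move=> w; apply: addr_ge0].
rewrite (ge0_expectationD P (f := cst s))//.
rewrite expectation_cst ge0_expectationZl//.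
rewrite (ge0_expectation_sum P _ (f := fun kk => E ^~ kk))//.
apply: (@le_trans _ _ ((2 / l)%:E * (s%:E + (expR (- s))%:E *
    (expR (36 * p1%:R) * expR (chernoff_const * p1%:R))%:E))%E).
  apply: lee_wpmul2l; first by rewrite lee_fin divr_ge0// ltW.
  apply: leeD2l; apply: lee_wpmul2l; first by rewrite lee_fin expR_ge0.
  rewrite big_enum/=.
  apply: (@le_trans _ _ (\sum_(kk in [predX lattice_net p1 & lattice_net p1])
      (expR (chernoff_const * p1%:R))%:E)%E).
    by apply: lee_sum => kk; exact: EE.
  rewrite sumEFin lee_fin sumr_const -[leLHS]mulr_natl ler_wpM2r ?expR_ge0// cardX natrM.
  rewrite (_ : 36 * p1%:R = 18 * p1%:R + 18 * p1%:R); last by ring.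
  rewrite expRD; apply: ler_pM => //; exact: card_lattice_net.
rewrite [leLHS](_ : _ = (2 / l * (s + expR (- s) * (expR (36 * p1%:R) *
  expR (chernoff_const * p1%:R))))%:E)//.
rewrite lee_fin -!expRD.
rewrite (_ : - s + _ = 0); last by rewrite /s; ring.
rewrite expR0.
rewrite (_ : 2 / l = 64 * V / p1%:R); last first.
  by rewrite /l; field; rewrite !gt_eqF.
rewrite mulrAC ler_pdivrMr//.
rewrite [leRHS](_ : _ = 64 * V * ((37 + chernoff_const) * p1%:R)); last first.
  by rewrite /gram_const; ring.
apply: ler_wpM2l; first by apply: mulr_ge0 => //; exact: ltW.
by rewrite /s; lra.
Qed.

End expected_norm.

(** * From psi_2 norms to variance proxies, and control of the perturbation *)

Section psi2.
Context d (T : measurableType d) (R : realType) (P : probability T R).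

(** The strict inequality provides an admissible scale below [y] without any claim that the infimum
    is attained; enlarging the scale only decreases the exponential moment. *)
Lemma psi2norm_lt (X : T -> R) (y c : R) : measurable_fun setT X ->
  (psi2norm P X < y%:E)%E -> 0 < c -> 0 <= y -> y ^+ 2 <= c ->
  ('E_P[fun w => expR (X w ^+ 2 / c)] <= 2%:E)%E.
Proof.
move=> mX /ereal_inf_lt[_ [x [x0 Ex] <-]]; rewrite lte_fin => xy c0 y0 yc.
apply: le_trans Ex; apply: ge0_expectation_le => [| |w|w].
- by apply: measurableT_comp => //; apply: measurable_funM => //; exact: measurable_funX.
- apply: measurableT_comp => //; apply: measurable_funX; apply: measurable_funM => //.
  exact: measurableT_comp.
- exact: expR_ge0.
rewrite ler_expR expr_div_n real_normK ?num_real// ler_wpM2l ?sqr_ge0//.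
rewrite lef_pV2 ?posrE ?exprn_gt0//; nra.
Qed.

Lemma psi2norm_subgaussian (X : T -> R) (K s e : R) :
  measurable_fun setT X -> P.-integrable setT (EFin \o X) -> 'E_P[X]%E = 0%E ->
  0 < K -> 0 <= s -> 0 < e ->
  (0 < s -> (psi2norm P (fun w => X w / s)%R <= K%:E)%E) ->
  (s = 0 -> (psi2norm P X <= 0%:E)%E) ->
  forall t, ('E_P[fun w => expR (t * X w)] <=
    (expR (10 * K ^+ 2 * (s ^+ 2 + e) * t ^+ 2))%:E)%E.
Proof.
move=> mX iX EX K0 s0 e0 hs h0 t.
(* The factor 2 leaves room for strict inequalities. For [s = 0] the scale [K sqrt e] is positive
   and its square is at most [c]; for [s > 0] the scale [5 K / 4] exceeds [K], while
   [25/16 K^2 <= 2 K^2 <= c / s^2]. *)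
pose c := 2 * K ^+ 2 * (s ^+ 2 + e).
have c0 : 0 < c.
  by rewrite /c; apply: mulr_gt0; [apply: mulr_gt0 => //; exact: exprn_gt0|
     apply: ltr_wpDl => //; exact: sqr_ge0].
have -> : 10 * K ^+ 2 * (s ^+ 2 + e) = 5 * c by rewrite /c; ring.
apply: expectation_expR_subgaussian => //.
move: s0; rewrite le_eqVlt => /orP[/eqP/esym s0|s0].
  apply: (@psi2norm_lt _ (K * Num.sqrt e)) => //.
  - by apply: le_lt_trans (h0 s0) _; rewrite lte_fin mulr_gt0 ?sqrtr_gt0.
  - by rewrite mulr_ge0 ?sqrtr_ge0// ltW.
  - rewrite exprMn sqr_sqrtr ?ltW// /c s0 expr0n add0r.
    by have := exprn_gt0 2 K0; nra.
have -> : (fun w => expR (X w ^+ 2 / c)) =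
    (fun w => expR ((X w / s) ^+ 2 / (c / s ^+ 2))).
  by apply/funext => w; congr expR; field; rewrite !gt_eqF.
apply: (@psi2norm_lt _ (5 / 4 * K)).
- exact: measurable_funM.
- by apply: le_lt_trans (hs s0) _; rewrite lte_fin; lra.
- by rewrite divr_gt0// exprn_gt0.
- by rewrite mulr_ge0// ltW.
- rewrite ler_pdivlMr ?exprn_gt0// /c.
  have k2 := exprn_gt0 2 K0; have s2 := exprn_gt0 2 s0.
  rewrite exprMn; have := mulr_gt0 k2 s2; have := mulr_gt0 k2 e0; nra.
Qed.

End psi2.

(** The error is linear in [e], so it vanishes in the limit. The proof uses
    [(x + e)^2 <= 2 (x^2 + e^2)], and [n <= n^2] for the integer [n = p1 p2] to absorb [n e^2] into
    [(n e)^2]. *)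
Lemma sqrt_sum_perturb {R : realType} (p1 p2 : nat) (x : 'I_p2 -> R) (a e : R) :
  0 <= a -> 0 <= e -> (forall j, 0 <= x j) ->
  Num.sqrt (p1%:R * \sum_j (a * (x j + e)) ^+ 2) <=
  2 * a * (Num.sqrt (p1%:R * \sum_j x j ^+ 2) + (p1 * p2)%:R * e).
Proof.
move=> a0 e0 x0; set S := Num.sqrt (p1%:R * \sum_j x j ^+ 2).
have B0 : 0 <= \sum_j x j ^+ 2 by apply: sumr_ge0 => j _; exact: sqr_ge0.
have S0 : 0 <= S by exact: sqrtr_ge0.
have S2 : S ^+ 2 = p1%:R * \sum_j x j ^+ 2 by rewrite sqr_sqrtr// mulr_ge0.
set n : R := (p1 * p2)%:R; have n0 : 0 <= n by exact: ler0n.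
have nn : n <= n ^+ 2.
  by rewrite /n -natrX ler_nat; case: (p1 * p2)%N => // k; rewrite leq_pmulr.
have r0 : 0 <= 2 * a * (S + n * e) by rewrite !mulr_ge0// addr_ge0// mulr_ge0.
rewrite -(ger0_norm r0) -sqrtr_sqr; apply: ler_wsqrtr.
apply: (@le_trans _ _ (p1%:R * \sum_j (2 * a ^+ 2 * (x j ^+ 2 + e ^+ 2)))).
  rewrite ler_wpM2l// ler_sum// => j _.
  have := sqr_ge0 (a * (x j - e)); nra.
rewrite -mulr_sumr big_split/= sumr_const card_ord.
have -> : p1%:R * (2 * a ^+ 2 * (\sum_j x j ^+ 2 + e ^+ 2 *+ p2)) =
    2 * a ^+ 2 * (S ^+ 2 + n * e ^+ 2).
  by rewrite S2 /n natrM -mulr_natr; ring.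
have -> : (2 * a * (S + n * e)) ^+ 2 = 2 * a ^+ 2 * (2 * (S + n * e) ^+ 2) by ring.
rewrite ler_wpM2l ?mulr_ge0 ?sqr_ge0//.
have h1 : n * e ^+ 2 <= n ^+ 2 * e ^+ 2 by rewrite ler_wpM2r ?sqr_ge0.
have h2 : 0 <= S * (n * e) by rewrite !mulr_ge0.
have := sqr_ge0 (n * e); have := sqr_ge0 S; nra.
Qed.

Unset Implicit Arguments.

Theorem theorem3p6 (R : realType) (C_K : R) (hCK : 0 < C_K) :
  exists C : R, 0 < C /\
  forall (d : measure_display) (T : measurableType d) (P : probability T R)
    (p1 p2 : nat) (Z : 'I_p1 -> 'I_p2 -> T -> R) (sigma : 'I_p2 -> R),
    (forall i j, measurable_fun setT (Z i j)) ->
    mutually_independent P (fun ij : 'I_p1 * 'I_p2 => Z ij.1 ij.2) ->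
    (forall i j, P.-integrable setT (EFin \o Z i j)) ->
    (forall i j, ('E_P[Z i j] = 0)%E) ->
    (forall j, 0 <= sigma j) ->
    (forall i j, 0 < sigma j -> (psi2norm P (fun w => Z i j w / sigma j)%R <= C_K%:E)%E) ->
    (forall i j, sigma j = 0 -> (psi2norm P (Z i j) <= 0%:E)%E) ->
    let EZZt : 'M[R]_p1 :=
      \matrix_(i, k) fine ('E_P[fun w => (rmat Z w *m (rmat Z w)^T) i k])%E in
    ('E_P[fun w => specnorm (rmat Z w *m (rmat Z w)^T - EZZt)]
      <= ((C * (Num.sqrt (p1%:R * \sum_(j < p2) sigma j ^+ 4)
               + p1%:R * \big[Num.max/0]_(j < p2) sigma j ^+ 2))%R)%:E)%E.
Proof.
pose a := 10 * C_K ^+ 2.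
have a0 : 0 < a by apply: mulr_gt0 => //; exact: exprn_gt0.
have G0 : 0 < gram_const :> R.
  apply: mulr_gt0 => //; have C0 : 0 <= chernoff_const :> R := chernoff_const_ge0.
  by apply: ltr_wpDr.
(* Here [a] is the ratio of variance proxy to perturbed variance, and the factor 2 is the loss in
   [sqrt_sum_perturb]. *)
exists (gram_const * (2 * a)); split; first by apply: mulr_gt0 => //; exact: mulr_gt0.
move=> d T P p1 p2 Z sigma mZ indZ iZ EZ s0 hs h0; cbv zeta.
set S := Num.sqrt _; set M := \big[_/_]_(_ < _) _.
have M0 : 0 <= M by exact: bigmax_ge_id.
(* [K] is the total coefficient of the perturbation [del] in the final bound. It may depend on the
   dimensions because [del] is chosen after them, and it may be 0, so [del] is defined with [K + 1]
   in the denominator. *)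
pose K := gram_const * (2 * a * (p1 * p2)%:R + p1%:R * a).
have K0 : 0 <= K.
  apply: mulr_ge0; first exact: ltW.
  by apply: addr_ge0; apply: mulr_ge0 => //; rewrite ?mulr_ge0// ltW.
apply/lee_addgt0Pr => e e0.
pose del := e / (K + 1); have K1 : 0 < K + 1 by lra.
have del0 : 0 < del by exact: divr_gt0.
have Kdel : K * del <= e.
  by rewrite /del mulrA ler_pdivrMr// mulrC ler_pM2l//; lra.
pose b j := a * (sigma j ^+ 2 + del).
have b0 j : 0 < b j by apply: mulr_gt0 => //; apply: ltr_wpDl => //; exact: sqr_ge0.
have bm j : b j <= a * (M + del).
  rewrite ler_pM2l// lerD2r.
  exact: (le_bigmax _ (fun j => sigma j ^+ 2)).
have m0 : 0 < a * (M + del) by apply: mulr_gt0 => //; apply: ltr_wpDl.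
have sgZ i j t : ('E_P[fun w => expR (t * Z i j w)] <= (expR (b j * t ^+ 2))%:E)%E.
  exact: psi2norm_subgaussian (mZ i j) (iZ i j) (EZ i j) hCK (s0 j) del0 (hs i j) (h0 i j) t.
apply: le_trans (expectation_specnorm_centered_gram b0 m0 bm mZ indZ sgZ) _.
rewrite -EFinD lee_fin.
have := @sqrt_sum_perturb _ p1 p2 (fun j => sigma j ^+ 2) a del (ltW a0) (ltW del0)
  (fun j => sqr_ge0 _).
under [X in 2 * a * (Num.sqrt (_ * X) + _)]eq_bigr do rewrite -exprM.
rewrite -/S => hS.
apply: le_trans (_ : gram_const * (2 * a * (S + (p1 * p2)%:R * del) + p1%:R * (a * (M + del))) <= _).
  by rewrite ler_pM2l// lerD2r.
have pM : 0 <= gram_const * (p1%:R * a * M).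
  by apply: mulr_ge0; [exact: ltW|apply: mulr_ge0 => //; apply: mulr_ge0 => //; exact: ltW].
apply: le_trans (_ : gram_const * (2 * a) * (S + p1%:R * M) + K * del <= _); last first.
  by rewrite lerD2l.
by rewrite /K; nra.
Qed.
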